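(* Consider the eigenvalue problem $-u^{(6)}(x)=\lambda u(x)$ for $x\in[0,1]$, with $u(0)=u'(0)=u''(0)=0$ and $u(1)=u'(1)=u''(1)=0$. Its eigenvalues, listed in increasing order, can be indexed as $\{\lambda_{n,3}\}_{n=2}^\infty$ so that $$\lambda_{n,3}=(n\pi)^6 \quad\text{if } n\ge 2 \text{ is even},\qquad \lambda_{n,3}=(n\pi+\delta_n)^6\quad\text{if } n\ge 3 \text{ is odd},$$ where the $\delta_n$ ($n\ge 3$ odd) are nonzero real numbers satisfying $$\delta_n\sim 8\,(-1)^{\lfloor n/2\rfloor+1}e^{-(\pi\sqrt3/2)n}\quad (n\to\infty),$$ with $\lfloor n/2\rfloor$ the integer part of $n/2$ and $x_n\sim y_n$ meaning $x_n/y_n\to1$. In particular $\lambda_{n,3}^{1/6}=n\pi$ if and only if $n$ is even.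
   Context: The eigenvalues of this boundary value problem form a sequence of positive numbers tending to infinity. *)

(* Defs.v *)
From Stdlib Require Import Reals Lra Lia.
From Coquelicot Require Import Coquelicot.
Open Scope R_scope.

Definition smooth6 (u : R -> R) : Prop :=
  forall (k : nat) (x : R), (k <= 6)%nat -> ex_derive_n u k x.

Definition bc3 (u : R -> R) : Prop :=
  forall k : nat, (k <= 2)%nat -> Derive_n u k 0 = 0 /\ Derive_n u k 1 = 0.

(* The complex number lambda = p + i q is an eigenvalue of
   -u^(6) = lambda u on [0,1] with the boundary conditions bc3:
   there is a complex-valued u = a + i b, not identically zero on [0,1],
   solving the problem.  Splitting into real and imaginary parts:
   -a^(6) = p a - q b,  -b^(6) = q a + p b. *)
Definition is_eigenvalue (p q : R) : Prop :=
  exists a b : R -> R,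
    smooth6 a /\ smooth6 b /\ bc3 a /\ bc3 b /\
    (exists x, 0 <= x <= 1 /\ (a x <> 0 \/ b x <> 0)) /\
    (forall x, 0 <= x <= 1 ->
       - Derive_n a 6 x = p * a x - q * b x /\
       - Derive_n b 6 x = q * a x + p * b x).

(* Main.v *)
(** Pairing an eigenfunction with itself in Lagrange's identity shows that the eigenvalues are real
    and positive, so write [lambda = (2 t)^6] with [t > 0]. The solutions of [u^(6) = -(2 t)^6 u]
    split into those even and those odd about [x = 1/2]. Pairing an eigenfunction [u] with the even
    ones gives a homogeneous 3x3 system for the end values of [u^(3)], [u^(4)], [u^(5)] whose
    determinant is a multiple of [sin t (cosh (sqrt 3 t) - cos t)]; the odd ones give the determinant
    [cos t cosh (sqrt 3 t) + cos^2 t - 2]. If neither vanishes then [u] has zero Cauchy data at [0],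
    hence [u = 0]; if one vanishes, an eigenfunction of that parity is explicit. The roots of the
    first are [t = n PI / 2] with [n] even; the second has exactly one root close to [n PI / 2] for
    each odd [n >= 3], and none near [PI / 2]. *)

Require Import Defs.
From Stdlib Require Import Reals Lra Lia ZArith Classical.
From Coquelicot Require Import Coquelicot.
Open Scope R_scope.

(** * Chains of successive derivatives, and monotone functions on [0,1] *)

(** Carrying the derivatives as an explicit sequence lets an arbitrary eigenfunction (through
    [Derive_n]) and the explicit solutions below enter the same identities. *)
Definition chain (n : nat) (v : nat -> R -> R) : Prop :=
  forall (k : nat) (x : R), (k < n)%nat -> is_derive (v k) x (v (S k) x).

Lemma smooth6_chain (u : R -> R) : smooth6 u -> chain 6 (Derive_n u).
Proof.
  intros Hu k x Hk. apply Derive_correct. apply (Hu (S k) x). lia.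
Qed.

Lemma chain_Derive_n (v : nat -> R -> R) :
  (forall n, chain n v) ->
  forall k x, ex_derive_n (v 0%nat) k x /\ Derive_n (v 0%nat) k x = v k x.
Proof.
  intros Hv.
  assert (HD : forall k x, Derive_n (v 0%nat) k x = v k x).
  { intros k; induction k as [|k IH]; intros x; [reflexivity|].
    simpl. rewrite (Derive_ext _ (v k) x IH).
    apply is_derive_unique, (Hv (S k)); lia. }
  intros k x; split; [|apply HD].
  destruct k as [|k]; [exact I|].
  simpl. apply ex_derive_ext with (v k); [intros; symmetry; apply HD|].
  eexists; apply (Hv (S k)); lia.
Qed.

Lemma derive_nonneg_incr (f df : R -> R) (x y : R) :
  (forall t, 0 <= t <= 1 -> is_derive f t (df t)) ->
  (forall t, 0 < t < 1 -> 0 <= df t) ->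
  0 <= x -> x <= y -> y <= 1 -> f x <= f y.
Proof.
  intros Hd Hp Hx Hxy Hy.
  destruct (Req_dec x y) as [->|Hne]; [lra|].
  destruct (MVT_cor2 f df x y) as [c [Hc1 Hc2]]; [lra| |].
  { intros c Hc. apply is_derive_Reals, Hd; lra. }
  assert (0 <= df c * (y - x)) by (apply Rmult_le_pos; [apply Hp|]; lra).
  lra.
Qed.

Lemma derive_of_locally_constant (f : R -> R) (df x c : R) :
  0 < x < 1 -> (forall t, 0 < t < 1 -> f t = c) -> is_derive f x df -> df = 0.
Proof.
  intros Hx Hf Hd.
  assert (H0 : is_derive f x 0).
  { apply is_derive_ext_loc with (fun _ => c); [|apply is_derive_Reals, derivable_pt_lim_const].
    assert (He : 0 < Rmin x (1 - x)) by (apply Rmin_pos; lra).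
    exists (mkposreal _ He). intros t Ht.
    unfold ball in Ht; simpl in Ht.
    unfold AbsRing_ball, abs, minus, plus, opp in Ht; simpl in Ht.
    pose proof (Rmin_l x (1 - x)); pose proof (Rmin_r x (1 - x)).
    apply Rabs_def2 in Ht. symmetry; apply Hf; lra. }
  apply is_derive_unique in H0. apply is_derive_unique in Hd. congruence.
Qed.

(** A nondecreasing function with equal end values is constant. This replaces integrating a
    nonnegative function to zero. *)
Lemma derive_nonneg_eq0 (f df : R -> R) :
  (forall x, 0 <= x <= 1 -> is_derive f x (df x)) ->
  (forall x, 0 < x < 1 -> 0 <= df x) ->
  f 0 = f 1 -> forall x, 0 < x < 1 -> df x = 0.
Proof.
  intros Hd Hp Hf x Hx.
  apply derive_of_locally_constant with f x (f 0); auto; [|apply Hd; lra].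
  intros t Ht.
  assert (f 0 <= f t) by (apply (derive_nonneg_incr f df); auto; lra).
  assert (f t <= f 1) by (apply (derive_nonneg_incr f df); auto; lra).
  lra.
Qed.

Lemma derive_eq0_const (f df : R -> R) (x : R) :
  (forall t, 0 <= t <= 1 -> is_derive f t (df t)) ->
  (forall t, 0 < t < 1 -> df t = 0) ->
  0 <= x <= 1 -> f x = f 0.
Proof.
  intros Hd H0 Hx.
  assert (f 0 <= f x).
  { apply (derive_nonneg_incr f df); auto; try lra. intros t Ht; rewrite H0; lra. }
  assert (- f 0 <= - f x).
  { apply (derive_nonneg_incr (fun t => - f t) (fun t => - df t)); auto; try lra.
    - intros t Ht. apply (is_derive_opp f), Hd, Ht.
    - intros t Ht; rewrite H0; lra. }
  lra.
Qed.

(** * Lagrange's identity, reality and positivity of the eigenvalues, uniqueness for Cauchy data *)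

(* Lagrange's bilinear concomitant of the operator [u^(6)]. *)
Definition concomitant (u v : nat -> R -> R) (x : R) : R :=
  u 0%nat x * v 5%nat x - u 1%nat x * v 4%nat x + u 2%nat x * v 3%nat x
  - u 3%nat x * v 2%nat x + u 4%nat x * v 1%nat x - u 5%nat x * v 0%nat x.

Ltac chain_derive H x :=
  let aux k := let E := fresh in
    pose proof (H k x ltac:(lia)) as E; cbv beta in E in
  aux 0%nat; aux 1%nat; aux 2%nat; aux 3%nat; aux 4%nat; aux 5%nat.

Ltac solve_derive :=
  auto_derive;
  [ repeat split; auto; eexists; eassumption
  | repeat match goal with
    | E : is_derive ?f ?x _ |- context [Derive (fun y => ?f y) ?x] =>
        change (Derive (fun y => f y) x) with (Derive f x);
        rewrite (is_derive_unique f x _ E)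
    | E : is_derive ?f ?x _ |- context [Derive ?f ?x] =>
        rewrite (is_derive_unique f x _ E)
    end; try ring ].

Lemma concomitant_derive (u v : nat -> R -> R) (x : R) :
  chain 6 u -> chain 6 v ->
  is_derive (concomitant u v) x (u 0%nat x * v 6%nat x - u 6%nat x * v 0%nat x).
Proof.
  intros Hu Hv. unfold concomitant. chain_derive Hu x. chain_derive Hv x.
  solve_derive.
Qed.

(** The first three terms of [concomitant u u], whose derivative telescopes: three integrations by
    parts of [u u^(6)]. *)
Lemma half_concomitant_derive (u : nat -> R -> R) (x : R) :
  chain 6 u ->
  is_derive (fun t => u 0%nat t * u 5%nat t - u 1%nat t * u 4%nat t + u 2%nat t * u 3%nat t)
    x (u 0%nat x * u 6%nat x + (u 3%nat x)^2).
Proof.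
  intros Hu. chain_derive Hu x. solve_derive.
Qed.

Lemma chain_eq0_down (u : nat -> R -> R) (k : nat) :
  chain 6 u -> (k < 6)%nat -> u k 0 = 0 ->
  (forall x, 0 < x < 1 -> u (S k) x = 0) -> forall x, 0 <= x <= 1 -> u k x = 0.
Proof.
  intros Hu Hk H0 HS x Hx. rewrite <- H0.
  apply derive_eq0_const with (u (S k)); auto.
Qed.

(* [concomitant u v], [u] and [v] being the real and imaginary parts of the eigenfunction, is
   monotone with derivative [-q |u + iv|^2] and vanishes at both ends; likewise its half version has
   derivative [-p |u + iv|^2 + |(u + iv)^(3)|^2]. *)
Lemma eigenvalue_real_pos (p q : R) : is_eigenvalue p q -> q = 0 /\ 0 < p.
Proof.
  intros (a & b & Sa & Sb & Ba & Bb & (x0 & Hx0 & Hne) & Heq).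
  apply smooth6_chain in Sa, Sb.
  set (u := Derive_n a) in *; set (v := Derive_n b) in *.
  assert (Hu : forall k, (k <= 2)%nat -> u k 0 = 0 /\ u k 1 = 0) by exact Ba.
  assert (Hv : forall k, (k <= 2)%nat -> v k 0 = 0 /\ v k 1 = 0) by exact Bb.
  assert (Ha : forall x, a x = u 0%nat x) by reflexivity.
  assert (Hb : forall x, b x = v 0%nat x) by reflexivity.
  setoid_rewrite Ha in Heq. setoid_rewrite Hb in Heq.
  rewrite Ha, Hb in Hne.
  destruct (Hu 0%nat ltac:(lia)) as [u00 u01], (Hu 1%nat ltac:(lia)) as [u10 u11],
    (Hu 2%nat ltac:(lia)) as [u20 u21], (Hv 0%nat ltac:(lia)) as [v00 v01],
    (Hv 1%nat ltac:(lia)) as [v10 v11], (Hv 2%nat ltac:(lia)) as [v20 v21].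
  clear Ba Bb Ha Hb Hu Hv. clearbody u v.
  assert (Hin : 0 < x0 < 1).
  { destruct (Req_dec x0 0) as [->|]; [lra|]. destruct (Req_dec x0 1) as [->|]; lra. }
  assert (Hsq : 0 < u 0%nat x0 ^ 2 + v 0%nat x0 ^ 2).
  { destruct Hne as [Hn|Hn]; apply Rsqr_pos_lt in Hn; unfold Rsqr in Hn; nra. }
  assert (Hbr : forall x, 0 <= x <= 1 -> is_derive (concomitant u v) x
             (- q * (u 0%nat x ^ 2 + v 0%nat x ^ 2))).
  { intros x Hx. destruct (Heq x Hx) as [E1 E2].
    replace (- q * _) with (u 0%nat x * v 6%nat x - u 6%nat x * v 0%nat x)
      by (replace (u 6%nat x) with (- (p * u 0%nat x - q * v 0%nat x)) by lra;
          replace (v 6%nat x) with (- (q * u 0%nat x + p * v 0%nat x)) by lra; ring).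
    apply concomitant_derive; assumption. }
  assert (Hz0 : concomitant u v 0 = 0)
    by (unfold concomitant; rewrite u00, u10, u20, v00, v10, v20; ring).
  assert (Hz1 : concomitant u v 1 = 0)
    by (unfold concomitant; rewrite u01, u11, u21, v01, v11, v21; ring).
  assert (Hq : q = 0).
  { destruct (Rle_dec q 0) as [Hq|Hq].
    - assert (- q * (u 0%nat x0 ^ 2 + v 0%nat x0 ^ 2) = 0); [|nra].
      apply (derive_nonneg_eq0 (concomitant u v)
        (fun x => - q * (u 0%nat x ^ 2 + v 0%nat x ^ 2))); auto; [|congruence].
      intros x _. apply Rmult_le_pos; nra.
    - assert (- (- q * (u 0%nat x0 ^ 2 + v 0%nat x0 ^ 2)) = 0); [|nra].
      apply (derive_nonneg_eq0 (fun x => - concomitant u v x)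
        (fun x => - (- q * (u 0%nat x ^ 2 + v 0%nat x ^ 2)))); auto; [| |lra].
      + intros x Hx. apply (is_derive_opp (concomitant u v)); auto.
      + intros x _. assert (0 <= q * (u 0%nat x ^ 2 + v 0%nat x ^ 2));
          [apply Rmult_le_pos; nra|lra]. }
  split; [exact Hq|]. subst q.
  apply Rnot_le_lt; intros Hp.
  set (g := fun w : nat -> R -> R => fun t =>
    w 0%nat t * w 5%nat t - w 1%nat t * w 4%nat t + w 2%nat t * w 3%nat t).
  assert (Hg : forall x, 0 < x < 1 ->
     - p * (u 0%nat x ^ 2 + v 0%nat x ^ 2) + (u 3%nat x ^ 2 + v 3%nat x ^ 2) = 0).
  { apply (derive_nonneg_eq0 (fun t => g u t + g v t)
      (fun x => - p * (u 0%nat x ^ 2 + v 0%nat x ^ 2) + (u 3%nat x ^ 2 + v 3%nat x ^ 2))).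
    - intros x Hx. destruct (Heq x Hx) as [E1 E2].
      replace (_ + _) with (plus (u 0%nat x * u 6%nat x + u 3%nat x ^ 2)
                              (v 0%nat x * v 6%nat x + v 3%nat x ^ 2))
        by (unfold plus; simpl; replace (u 6%nat x) with (- (p * u 0%nat x - 0 * v 0%nat x)) by lra;
            replace (v 6%nat x) with (- (0 * u 0%nat x + p * v 0%nat x)) by lra; ring).
      apply (is_derive_plus (g u) (g v)); apply half_concomitant_derive; assumption.
    - intros x _.
      assert (0 <= - p * (u 0%nat x ^ 2 + v 0%nat x ^ 2)) by (apply Rmult_le_pos; nra).
      nra.
    - unfold g. rewrite u00, u10, u20, v00, v10, v20, u01, u11, u21, v01, v11, v21. ring. }
  clear Hbr Hz0 Hz1.
  assert (H3 : forall x, 0 < x < 1 -> u 3%nat x = 0 /\ v 3%nat x = 0).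
  { intros x Hx. specialize (Hg x Hx).
    assert (0 <= - p * (u 0%nat x ^ 2 + v 0%nat x ^ 2)) by (apply Rmult_le_pos; nra).
    split; apply Rsqr_0_uniq; unfold Rsqr; nra. }
  (* A vanishing third derivative and zero data at 0 make the second derivative, the first and the
     function vanish in turn. *)
  assert (Hall : forall w : nat -> R -> R, chain 6 w ->
     w 0%nat 0 = 0 -> w 1%nat 0 = 0 -> w 2%nat 0 = 0 ->
     (forall x, 0 < x < 1 -> w 3%nat x = 0) -> w 0%nat x0 = 0).
  { intros w Hw w0 w1 w2 w3.
    assert (E2 := chain_eq0_down w 2 Hw ltac:(lia) w2 w3).
    assert (E1 := chain_eq0_down w 1 Hw ltac:(lia) w1 (fun x Hx => E2 x ltac:(lra))).
    apply (chain_eq0_down w 0 Hw ltac:(lia) w0 (fun x Hx => E1 x ltac:(lra))). lra. }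
  rewrite (Hall u), (Hall v) in Hsq; auto; try (intros; apply H3; auto).
  lra.
Qed.

(** Gronwall: the energy [E], the sum of the squares of the first six entries, satisfies
    [E' <= K E], so [E exp (- K x)] is nonincreasing from 0. *)
Lemma cauchy_uniqueness (u : nat -> R -> R) (p : R) :
  chain 6 u -> (forall k, (k < 6)%nat -> u k 0 = 0) ->
  (forall x, 0 <= x <= 1 -> u 6%nat x = - p * u 0%nat x) ->
  forall x, 0 <= x <= 1 -> u 0%nat x = 0.
Proof.
  intros Hu H0 Heq x Hx.
  set (E := fun x => u 0%nat x ^ 2 + u 1%nat x ^ 2 + u 2%nat x ^ 2 + u 3%nat x ^ 2
                     + u 4%nat x ^ 2 + u 5%nat x ^ 2).
  (* The products of neighbours cost at most [2 E], and the closing term [2 p y5 y0] at most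
     [Rabs p * E]. *)
  set (K := 2 + Rabs p).
  set (dE := fun x => 2 * (u 0%nat x * u 1%nat x + u 1%nat x * u 2%nat x
       + u 2%nat x * u 3%nat x + u 3%nat x * u 4%nat x + u 4%nat x * u 5%nat x
       + u 5%nat x * u 6%nat x)).
  assert (Hd : forall t, 0 <= t <= 1 ->
    is_derive (fun t => - (E t * exp (- (K * t)))) t
      ((K * E t - dE t) * exp (- (K * t)))).
  { intros t Ht. unfold E, dE. chain_derive Hu t. solve_derive. }
  assert (Hpos : forall t, 0 <= t <= 1 -> 0 <= (K * E t - dE t) * exp (- (K * t))).
  { intros t Ht. apply Rmult_le_pos; [|left; apply exp_pos].
    unfold dE, E, K. rewrite Heq by assumption.
    generalize (u 0%nat t) (u 1%nat t) (u 2%nat t) (u 3%nat t) (u 4%nat t) (u 5%nat t).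
    intros y0 y1 y2 y3 y4 y5.
    assert (- (2 * (y5 * (- p * y0))) + Rabs p * (y0^2 + y5^2) >= 0).
    { destruct (Rle_dec 0 p); [rewrite Rabs_pos_eq by lra|rewrite Rabs_left by lra].
      - assert (0 <= p * (y0 + y5)^2) by (apply Rmult_le_pos; [lra|apply pow2_ge_0]). lra.
      - assert (0 <= - p * (y0 - y5)^2) by (apply Rmult_le_pos; [lra|apply pow2_ge_0]). lra. }
    assert (0 <= Rabs p * (y1^2+y2^2+y3^2+y4^2))
      by (apply Rmult_le_pos; [apply Rabs_pos|repeat apply Rplus_le_le_0_compat; apply pow2_ge_0]).
    (* This sum of squares is exactly [2 E] minus twice the products of neighbours. *)
    assert (0 <= (y0-y1)^2 + (y1-y2)^2 + (y2-y3)^2+(y3-y4)^2+(y4-y5)^2 + y0^2+y5^2)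
      by (repeat apply Rplus_le_le_0_compat; apply pow2_ge_0).
    lra. }
  assert (HE : - (E 0 * exp (- (K * 0))) <= - (E x * exp (- (K * x)))).
  { apply (derive_nonneg_incr (fun t => - (E t * exp (- (K * t))))
      (fun t => (K * E t - dE t) * exp (- (K * t)))); [exact Hd| |lra..].
    intros; apply Hpos; lra. }
  assert (HE0 : E 0 = 0) by (unfold E; rewrite !H0 by lia; ring).
  rewrite HE0 in HE.
  assert (Hex := exp_pos (- (K * x))).
  assert (HEx : E x <= 0).
  { apply Rnot_lt_le; intros Hl. pose proof (Rmult_lt_0_compat _ _ Hl Hex). lra. }
  unfold E in HEx.
  pose proof (pow2_ge_0 (u 0%nat x)); pose proof (pow2_ge_0 (u 1%nat x));
    pose proof (pow2_ge_0 (u 2%nat x)); pose proof (pow2_ge_0 (u 3%nat x));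
    pose proof (pow2_ge_0 (u 4%nat x)); pose proof (pow2_ge_0 (u 5%nat x)).
  apply Rsqr_0_uniq; rewrite Rsqr_pow2; lra.
Qed.

(** * Roots of the characteristic functions *)

Definition odd_char (t : R) : R :=
  cos t * cosh (sqrt 3 * t) + cos t ^ 2 - 2.

Lemma cosh_ge_half_exp (x : R) : exp x / 2 <= cosh x.
Proof. unfold cosh. pose proof (exp_pos (- x)). lra. Qed.

Lemma cosh_gt_sinh_abs (x : R) : - cosh x < sinh x < cosh x.
Proof. unfold cosh, sinh. pose proof (exp_pos x). pose proof (exp_pos (- x)). lra. Qed.

Lemma sqrt3_sq : sqrt 3 * sqrt 3 = 3.
Proof. apply sqrt_sqrt; lra. Qed.

Lemma sqrt3_bounds : 17 / 10 < sqrt 3 < 18 / 10.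
Proof. pose proof sqrt3_sq. pose proof (sqrt_pos 3). split; nra. Qed.

Lemma PI_gt3 : 3 < PI.
Proof. pose proof PI2_3_2. lra. Qed.

(** The bound [1 + x < exp x] at the full argument is too weak; at half the argument, squared, it
    gives [exp (sqrt 3 * t) > 9]. *)
Lemma cosh_sqrt3_gt4 (t : R) : 3 <= t -> 4 < cosh (sqrt 3 * t).
Proof.
  intros Ht. pose proof sqrt3_bounds.
  assert (51 / 10 <= sqrt 3 * t) by nra.
  assert (E : exp (sqrt 3 * t) = exp (sqrt 3 * t / 2) * exp (sqrt 3 * t / 2))
    by (rewrite <- exp_plus; f_equal; lra).
  assert (1 + sqrt 3 * t / 2 < exp (sqrt 3 * t / 2)) by (apply exp_ineq1; lra).
  pose proof (cosh_ge_half_exp (sqrt 3 * t)).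
  assert (3 * 3 < exp (sqrt 3 * t)) by nra.
  lra.
Qed.

Lemma odd_char_neg_cos_nonpos (t : R) : cos t <= 0 -> odd_char t < 0.
Proof.
  intros Hc. unfold odd_char. pose proof (COS_bound t).
  assert (0 < cosh (sqrt 3 * t)).
  { pose proof (cosh_ge_half_exp (sqrt 3 * t)). pose proof (exp_pos (sqrt 3 * t)). lra. }
  nra.
Qed.

(* With [W = (1 + sin^2 t + sin t sqrt (3 + sin^2 t)) / cos t] one has
   [W + 1/W = 2 (1 + sin^2 t) / cos t], so the claim is [exp (sqrt 3 t) < W]. It holds since [L], that
   is [ln W - sqrt 3 t], vanishes at [0] and has derivative [(2 + cos^2) / (cos r) - sqrt 3],
   positive because [(2 + c^2)^2 - 3 c^2 (4 - c^2) = 4 (1 - c^2)^2]. *)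
Lemma odd_char_neg_first_quarter (t : R) : 0 < t < PI / 2 -> odd_char t < 0.
Proof.
  intros Ht. pose proof sqrt3_sq as H3. pose proof sqrt3_bounds as Hb.
  set (r := fun x => sqrt (3 + sin x ^ 2)).
  set (L := fun x => ln (1 + sin x ^ 2 + sin x * r x) - ln (cos x) - sqrt 3 * x).
  assert (Hr : forall x, 0 < r x /\ r x * r x = 3 + sin x ^ 2).
  { intros x. unfold r. assert (0 < 3 + sin x ^ 2) by nra.
    split; [apply sqrt_lt_R0|apply sqrt_sqrt]; lra. }
  assert (Hcs : forall x, 0 <= x < PI / 2 -> 0 < cos x /\ 0 <= sin x).
  { intros x Hx. split; [apply cos_gt_0; lra|apply sin_ge_0; lra]. }
  assert (Hd : forall x, 0 <= x <= t ->
     derivable_pt_lim L x ((2 + cos x ^ 2) / (cos x * r x) - sqrt 3)).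
  { intros x Hx. destruct (Hcs x) as [Hc Hs]; [lra|]. destruct (Hr x) as [Hrp Hrs].
    pose proof (sin2_cos2 x) as H1. unfold Rsqr in H1.
    apply is_derive_Reals. unfold L, r.
    assert (0 < 1 + sin x ^ 2 + sin x * r x) by nra.
    auto_derive; [fold (r x); repeat split; auto; nra|].
    fold (r x).
    replace (sqrt _) with (r x) by (unfold r; f_equal; ring).
    set (A := 1 + sin x ^ 2 + sin x * r x) in *.
    apply Rminus_diag_uniq.
    match goal with |- ?X = 0 => replace X with
     (((2 * sin x * cos x * r x + cos x * (r x * r x) + sin x ^ 2 * cos x) * cos x
        + sin x * r x * A - (2 + cos x ^ 2) * A) / (cos x * r x * A)) end.
    2:{ unfold A; field. fold A; repeat split; nra. }
    apply Rmult_eq_0_compat_r. unfold A. rewrite Hrs.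
    replace (cos x ^ 2) with (1 - sin x ^ 2) by nra.
    transitivity (cos x * cos x * (2 * sin x * r x + 3 + 2 * sin x ^ 2)
      + (sin x * r x - (3 - sin x ^ 2)) * (1 + sin x ^ 2 + sin x * r x)); [ring|].
    replace (cos x * cos x) with (1 - sin x ^ 2) by nra.
    transitivity (sin x ^ 2 * (r x * r x - (3 + sin x ^ 2))); [ring|rewrite Hrs; ring]. }
  assert (HL : 0 < L t).
  { destruct (MVT_cor2 L (fun x => (2 + cos x ^ 2) / (cos x * r x) - sqrt 3) 0 t)
      as (x & E & Hx); [lra|exact Hd|].
    assert (L0 : L 0 = 0).
    { unfold L. rewrite sin_0, cos_0.
      replace (1 + 0 ^ 2 + 0 * r 0) with 1 by ring. rewrite ln_1. ring. }
    rewrite L0 in E. replace (L t) with (((2 + cos x ^ 2) / (cos x * r x) - sqrt 3) * (t - 0)) by lra.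
    apply Rmult_lt_0_compat; [|lra].
    destruct (Hcs x) as [Hc _]; [lra|]. destruct (Hr x) as [Hrp Hrs].
    assert (Hs : 0 < sin x) by (apply sin_gt_0; lra).
    pose proof (sin2_cos2 x) as H1. unfold Rsqr in H1.
    assert (Hp : 0 < cos x * r x) by (apply Rmult_lt_0_compat; lra).
    cut (sqrt 3 * (cos x * r x) < 2 + cos x ^ 2).
    { intros Hlt. apply Rlt_0_minus. apply Rmult_lt_reg_r with (cos x * r x); [exact Hp|].
      replace ((2 + cos x ^ 2) / (cos x * r x) * (cos x * r x)) with (2 + cos x ^ 2)
        by (field; lra). exact Hlt. }
    apply Rsqr_incrst_0; [|nra|nra]. unfold Rsqr.
    replace (sqrt 3 * (cos x * r x) * (sqrt 3 * (cos x * r x)))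
      with ((sqrt 3 * sqrt 3) * (cos x * cos x) * (r x * r x)) by ring.
    rewrite H3, Hrs. replace (sin x ^ 2) with (1 - cos x * cos x) by nra.
    assert (0 < (1 - cos x * cos x) ^ 2) by (apply pow_lt; nra).
    nra. }
  destruct (Hcs t) as [Hc _]; [lra|]. destruct (Hr t) as [Hrp Hrs].
  assert (Hs : 0 < sin t) by (apply sin_gt_0; lra).
  pose proof (sin2_cos2 t) as H1. unfold Rsqr in H1.
  set (A := 1 + sin t ^ 2 + sin t * r t) in *.
  (* [A / cos t] is [W] and [B / cos t] is its inverse. *)
  set (B := 1 + sin t ^ 2 - sin t * r t).
  assert (HA : 0 < A) by (unfold A; nra).
  assert (HAB : A * B = cos t * cos t).
  { unfold A, B. replace (cos t * cos t) with (1 - sin t * sin t) by lra.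
    transitivity ((1 + sin t ^ 2) ^ 2 - sin t ^ 2 * (r t * r t)); [ring|].
    rewrite Hrs; ring. }
  set (E := exp (sqrt 3 * t)).
  assert (HE : 1 < E) by (unfold E; pose proof (exp_ineq1 (sqrt 3 * t)); nra).
  assert (HEA : E * cos t < A).
  { unfold L in HL. fold A in HL.
    apply ln_lt_inv; [nra|exact HA|]. rewrite ln_mult by lra.
    unfold E. rewrite ln_exp. lra. }
  assert (HEinv : exp (- (sqrt 3 * t)) = / E) by apply exp_Ropp.
  unfold odd_char, cosh. rewrite HEinv. fold E.
  assert (Hk : (E + / E) * cos t < A + B).
  { apply Rmult_lt_reg_r with (E * A); [nra|].
    replace ((E + / E) * cos t * (E * A)) with ((E * E + 1) * cos t * A) by (field; lra).
    replace ((A + B) * (E * A)) with (E * (A * A + A * B)) by ring. rewrite HAB.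
    (* Since [x + 1/x] increases for [x > 1], [E < W] gives the claim; cleared of denominators, the
       difference is this product. *)
    assert (0 < (A - E * cos t) * (E * A - cos t)); [|nra].
    apply Rmult_lt_0_compat; nra. }
  unfold A, B in Hk. nra.
Qed.

(** * Roots near the odd multiples of [PI / 2] *)

Definition eps (k : nat) : R := (-1) ^ k.

Definition center (k : nat) : R := INR (2 * k + 3) * PI / 2.

(* [odd_char] in the coordinate [t], the signed distance from the centre [(2k+3) PI / 2]; the sign [eps k]
   makes the cosine become [sin t] for every [k]. *)
Definition local_odd_char (k : nat) (t : R) : R :=
  sin t * cosh (sqrt 3 * (center k + eps k * t)) + sin t ^ 2 - 2.

Lemma eps_pm (k : nat) : eps k = 1 \/ eps k = -1.
Proof. unfold eps. induction k as [|k [IH|IH]]; simpl; rewrite ?IH; lra. Qed.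

Lemma eps_bound (k : nat) (t : R) : 0 <= t -> - t <= eps k * t <= t.
Proof. destruct (eps_pm k) as [-> | ->]; lra. Qed.

Lemma cos_shift_INR_PI (x : R) (k : nat) : cos (x + INR k * PI) = eps k * cos x.
Proof.
  induction k as [|k IH].
  - unfold eps; simpl. rewrite Rmult_0_l, Rplus_0_r. ring.
  - rewrite S_INR. replace (x + (INR k + 1) * PI) with (x + INR k * PI + PI) by ring.
    rewrite neg_cos, IH. unfold eps; simpl. ring.
Qed.

Lemma center_eq (k : nat) : center k = 3 * (PI / 2) + INR k * PI.
Proof. unfold center. rewrite plus_INR, mult_INR. simpl. field. Qed.

Lemma cos_center (k : nat) (t : R) : cos (center k + eps k * t) = sin t.
Proof.
  rewrite center_eq.
  replace (3 * (PI / 2) + INR k * PI + eps k * t)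
    with (3 * (PI / 2) + eps k * t + INR k * PI) by ring.
  rewrite cos_shift_INR_PI.
  replace (3 * (PI / 2) + eps k * t) with (PI / 2 + eps k * t + PI) by field.
  rewrite neg_cos.
  replace (cos (PI/2 + eps k * t)) with (- sin (eps k * t))
   by (rewrite sin_cos; ring).
  destruct (eps_pm k) as [-> | ->].
  - rewrite !Rmult_1_l; ring.
  - replace (-1 * t) with (- t) by ring. rewrite sin_neg. ring.
Qed.

Lemma odd_char_center (k : nat) (t : R) : odd_char (center k + eps k * t) = local_odd_char k t.
Proof. unfold odd_char, local_odd_char. rewrite cos_center. reflexivity. Qed.

Lemma local_odd_char_derive (k : nat) (t : R) :
  derivable_pt_lim (local_odd_char k) t
    (cos t * cosh (sqrt 3 * (center k + eps k * t))
     + sqrt 3 * eps k * sin t * sinh (sqrt 3 * (center k + eps k * t))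
     + 2 * sin t * cos t).
Proof.
  apply is_derive_Reals. unfold local_odd_char, cosh, sinh. auto_derive; [exact I|].
  unfold Rdiv. ring.
Qed.

(** Below [PI / 6] one has [sqrt 3 * sin < cos], and [sinh] is smaller than [cosh] in absolute
    value, so the first term of the derivative dominates the [sinh] term whatever the sign
    [eps k]. *)
Lemma local_odd_char_incr (k : nat) (x y : R) :
  0 <= x -> x < y -> y <= PI / 6 -> local_odd_char k x < local_odd_char k y.
Proof.
  intros Hx Hxy Hy. pose proof PI_RGT_0.
  destruct (MVT_cor2 (local_odd_char k) _ x y Hxy (fun c _ => local_odd_char_derive k c))
    as (c & E & Hc).
  cut (0 < (local_odd_char k y - local_odd_char k x)); [lra|]. rewrite E.
  apply Rmult_lt_0_compat; [|lra].
  assert (Hs : 0 < sin c) by (apply sin_gt_0; lra).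
  assert (Hc1 : 0 < cos c) by (apply cos_gt_0; lra).
  assert (Hs2 : sin c < 1 / 2) by (rewrite <- sin_PI6; apply sin_increasing_1; lra).
  set (z := sqrt 3 * (center k + eps k * c)).
  pose proof (cosh_gt_sinh_abs z) as Hz. pose proof sqrt3_sq. pose proof sqrt3_bounds.
  pose proof (sin2_cos2 c) as Hcs1. unfold Rsqr in Hcs1.
  assert (Hcs : sqrt 3 * sin c < cos c).
  { apply Rsqr_incrst_0; [unfold Rsqr; nra|nra|lra]. }
  assert (0 < sin c * cos c) by (apply Rmult_lt_0_compat; lra).
  assert (sqrt 3 * sin c * cosh z < cos c * cosh z) by (apply Rmult_lt_compat_r; lra).
  assert (0 < sqrt 3 * sin c) by nra.
  destruct (eps_pm k) as [-> | ->]; nra.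
Qed.

(** Intermediate values: -2 at 0, and above [4 / 2 + 1 / 4 - 2] at [PI / 6]. The informative form
    allows [tau] to be defined by projection. *)
Lemma tau_exists (k : nat) : {t : R | 0 < t < PI / 6 /\ local_odd_char k t = 0}.
Proof.
  assert (H0 : local_odd_char k 0 < 0) by (unfold local_odd_char; rewrite sin_0; lra).
  assert (HPI := PI_gt3).
  assert (H6 : 0 < local_odd_char k (PI / 6)).
  { unfold local_odd_char. rewrite sin_PI6.
    cut (4 < cosh (sqrt 3 * (center k + eps k * (PI / 6)))); [lra|].
    apply cosh_sqrt3_gt4. rewrite center_eq. pose proof (pos_INR k).
    pose proof (eps_bound k (PI / 6) ltac:(lra)). nra. }
  destruct (IVT (local_odd_char k) 0 (PI / 6)) as [t [Ht E]]; auto; try lra.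
  { intros t. apply derivable_continuous_pt. eexists; apply local_odd_char_derive. }
  exists t. split; [|exact E].
  split; apply Rnot_le_lt; intros Hl;
    [assert (t = 0) by lra|assert (t = PI / 6) by lra]; subst; lra.
Qed.

Definition tau (k : nat) : R := proj1_sig (tau_exists k).

Lemma tau_spec (k : nat) : 0 < tau k < PI / 6 /\ local_odd_char k (tau k) = 0.
Proof. exact (proj2_sig (tau_exists k)). Qed.

(** A root has positive cosine, hence lies beyond [PI]. In its interval of length [PI] about
    [center k], positive cosine forces local coordinate [s > 0], the large [cosh] forces
    [s < PI / 6], and monotonicity leaves only [tau k]. *)
Lemma odd_char_roots (t : R) :
  0 < t -> (odd_char t = 0 <-> exists k, t = center k + eps k * tau k).
Proof.
  intros Ht. assert (HPI := PI_gt3). split.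
  2:{ intros [k ->]. rewrite odd_char_center. apply tau_spec. }
  intros HF.
  assert (Hc : 0 < cos t).
  { apply Rnot_le_lt; intros Hl. apply odd_char_neg_cos_nonpos in Hl. lra. }
  assert (Hge : PI < t).
  { apply Rnot_le_lt; intros Hl. destruct (Rlt_dec t (PI / 2)) as [Hlt|Hlt].
    - pose proof (odd_char_neg_first_quarter t ltac:(lra)). lra.
    - pose proof (cos_le_0 t ltac:(lra) ltac:(lra)). lra. }
  (* The intervals of length [PI] starting at [PI] are centred at the points [center k]. *)
  destruct (nfloor_ex ((t - PI) / PI)) as [k [Hk1 Hk2]].
  { apply Rdiv_le_0_compat; lra. }
  assert (Hk : INR k * PI <= t - PI < (INR k + 1) * PI).
  { replace (t - PI) with ((t - PI) / PI * PI) by (field; lra).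
    split; [apply Rmult_le_compat_r|apply Rmult_lt_compat_r]; lra. }
  set (s := eps k * (t - center k)).
  assert (Hts : t = center k + eps k * s).
  { unfold s. destruct (eps_pm k) as [-> | ->]; ring. }
  assert (Hs : - (PI / 2) <= s <= PI / 2).
  { unfold s. rewrite center_eq. destruct (eps_pm k) as [-> | ->]; lra. }
  exists k. rewrite Hts in HF, Hc |- *. rewrite odd_char_center in HF. rewrite cos_center in Hc.
  assert (Hs0 : 0 < s).
  { apply Rnot_le_lt; intros Hl. pose proof (sin_ge_0 (- s) ltac:(lra) ltac:(lra)) as H.
    rewrite sin_neg in H. lra. }
  assert (Hsin : sin s < 1 / 2).
  { pose proof (cosh_sqrt3_gt4 t ltac:(lra)) as H4. rewrite Hts in H4.
    unfold local_odd_char in HF. nra. }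
  assert (Hs6 : s < PI / 6).
  { rewrite <- sin_PI6 in Hsin. apply sin_increasing_0 in Hsin; lra. }
  destruct (tau_spec k) as [Hb Hz].
  do 2 f_equal.
  destruct (Rtotal_order s (tau k)) as [Hl|[He|Hl]]; [|exact He|];
    apply (local_odd_char_incr k) in Hl; lra.
Qed.

(** * Increasing enumeration of all positive roots *)

(* Half the sixth root of the [n]-th eigenvalue; meaningful for [n >= 2] only. *)
Definition theta (n : nat) : R :=
  INR n * PI / 2 + (if Nat.even n then 0 else eps ((n - 3) / 2) * tau ((n - 3) / 2)).

Lemma theta_even (n : nat) : Nat.even n = true -> theta n = INR n * PI / 2.
Proof. intros H. unfold theta. rewrite H. ring. Qed.

Lemma theta_odd (k : nat) : theta (2 * k + 3) = center k + eps k * tau k.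
Proof.
  unfold theta, center.
  replace (Nat.even (2 * k + 3)) with false
    by (symmetry; rewrite Nat.add_comm; apply Nat.even_add_mul_2).
  replace ((2 * k + 3 - 3) / 2)%nat with k; [reflexivity|].
  replace (2 * k + 3 - 3)%nat with (k * 2)%nat by lia.
  rewrite Nat.div_mul; lia.
Qed.

Lemma theta_bound (n : nat) : INR n * PI / 2 - PI / 6 < theta n < INR n * PI / 2 + PI / 6.
Proof.
  unfold theta. pose proof PI_RGT_0. destruct (Nat.even n); [lra|].
  destruct (tau_spec ((n - 3) / 2)) as [Hb _].
  pose proof (eps_bound ((n - 3) / 2) (tau ((n - 3) / 2)) ltac:(lra)). lra.
Qed.

Lemma theta_pos (n : nat) : (1 <= n)%nat -> 0 < theta n.
Proof.
  intros Hn. pose proof (theta_bound n). pose proof PI_RGT_0.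
  apply le_INR in Hn. simpl in Hn. nra.
Qed.

(** Consecutive unperturbed values are [PI / 2] apart, while two displacements together stay below
    [PI / 3]. *)
Lemma theta_incr (m n : nat) : (m < n)%nat -> theta m < theta n.
Proof.
  intros Hmn. pose proof (theta_bound m). pose proof (theta_bound n). pose proof PI_RGT_0.
  apply le_INR in Hmn. rewrite S_INR in Hmn. nra.
Qed.

Lemma odd_ge3 (n : nat) : (3 <= n)%nat -> Nat.even n = false -> exists k, n = (2 * k + 3)%nat.
Proof.
  intros Hn He. assert (Ho : Nat.odd n = true) by (unfold Nat.odd; rewrite He; reflexivity).
  apply Nat.odd_spec in Ho as [j ->]. exists (j - 1)%nat. lia.
Qed.

Lemma theta_roots (t : R) :
  0 < t -> (sin t = 0 \/ odd_char t = 0 <-> exists n, (2 <= n)%nat /\ t = theta n).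
Proof.
  intros Ht. pose proof PI_RGT_0. split.
  - intros [Hs|HF].
    + apply sin_eq_0_0 in Hs as [z Hz].
      assert (Hz0 : (0 < z)%Z) by (apply lt_IZR; nra).
      exists (2 * Z.to_nat z)%nat. split; [lia|].
      rewrite theta_even by (rewrite Nat.even_mul; reflexivity).
      rewrite mult_INR, INR_IZR_INZ with (n := Z.to_nat z), Z2Nat.id by lia. simpl. lra.
    + apply odd_char_roots in HF as [k ->]; [|exact Ht].
      exists (2 * k + 3)%nat. split; [lia|]. rewrite theta_odd. reflexivity.
  - intros (n & Hn & ->). destruct (Nat.even n) eqn:He.
    + left. rewrite theta_even by exact He. apply Nat.even_spec in He as [k ->].
      apply sin_eq_0_1. exists (Z.of_nat k). rewrite <- INR_IZR_INZ, mult_INR. simpl. field.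
    + right. destruct (odd_ge3 n) as [k ->]; [|exact He|].
      * destruct (Nat.eq_dec n 2) as [->|]; [discriminate|lia].
      * apply odd_char_roots; [apply theta_pos; lia|]. exists k. apply theta_odd.
Qed.

(** * Solutions even and odd about the midpoint *)

(* The roots of [z^6 = -m^6] are [+-i m] and [m (+-sqrt 3 +- i) / 2]; [e] tells whether the solution is
   even or odd about [1/2]. *)
Definition mode (m : R) (e : bool) (a b c x : R) : R :=
  let t := m * (x - 1 / 2) in
  let P := cosh (sqrt 3 / 2 * t) * cos (t / 2) in
  let Q := sinh (sqrt 3 / 2 * t) * sin (t / 2) in
  let S := sinh (sqrt 3 / 2 * t) * cos (t / 2) in
  let T := cosh (sqrt 3 / 2 * t) * sin (t / 2) in
  if e then a * cos t + b * P + c * Q else a * sin t + b * S + c * T.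

(* The [k]-th derivative: differentiating flips the parity and acts linearly on the coefficients. *)
Fixpoint modeD (k : nat) (m : R) (e : bool) (a b c : R) : R -> R :=
  match k with
  | O => mode m e a b c
  | S k => modeD k m (negb e) (m * (if e then - a else a))
             (m * (sqrt 3 / 2 * b + c / 2)) (m * (sqrt 3 / 2 * c - b / 2))
  end.

Lemma mode_derive (m : R) (e : bool) (a b c x : R) :
  is_derive (mode m e a b c) x (modeD 1 m e a b c x).
Proof.
  unfold modeD, mode, cosh, sinh. destruct e; simpl negb; cbv iota beta zeta;
  (auto_derive; [exact I|]).
  all: unfold Rdiv, Rminus; ring_simplify; field.
Qed.

Lemma modeD_chain (m : R) (e : bool) (a b c : R) (n : nat) :
  chain n (fun k => modeD k m e a b c).
Proof.
  intros k x _. revert e a b c. induction k as [|k IH]; intros e a b c.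
  - apply mode_derive.
  - apply IH.
Qed.

(** The cube of [(sqrt 3 + i) / 2] is [i], so three derivatives turn the pair [(b, c)] by a quarter
    turn. *)
Lemma modeD_3 (k : nat) (m : R) (e : bool) (a b c : R) :
  modeD (S (S (S k))) m e a b c =
  modeD k m (negb e) (m ^ 3 * (if e then a else - a)) (m ^ 3 * c) (- m ^ 3 * b).
Proof.
  pose proof sqrt3_sq as H3. cbn [modeD]. rewrite !Bool.negb_involutive.
  generalize dependent (sqrt 3). intros r H3. f_equal.
  - destruct e; simpl; ring.
  (* With [sqrt 3] generalized to [r], the two sides differ by a multiple of [r * r - 3], which is
     made explicit. *)
  - transitivity (m ^ 3 * c + m ^ 3 * (r * r - 3) * (b * r / 8 + 3 * c / 8));
      [field|rewrite H3; ring].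
  - transitivity (- m ^ 3 * b + m ^ 3 * (r * r - 3) * (c * r / 8 - 3 * b / 8));
      [field|rewrite H3; ring].
Qed.

Lemma modeD_6 (m : R) (e : bool) (a b c x : R) :
  modeD 6 m e a b c x = - m ^ 6 * modeD 0 m e a b c x.
Proof.
  rewrite !modeD_3, Bool.negb_involutive. unfold modeD, mode.
  destruct e; simpl; ring.
Qed.

Lemma mode_parity (m : R) (e : bool) (a b c : R) :
  mode m e a b c 0 = (if e then 1 else -1) * mode m e a b c 1.
Proof.
  unfold mode. cbv zeta.
  replace (m * (0 - 1 / 2)) with (- (m / 2)) by field.
  replace (m * (1 - 1 / 2)) with (m / 2) by field.
  replace (sqrt 3 / 2 * - (m / 2)) with (- (sqrt 3 / 2 * (m / 2))) by ring.
  replace (- (m / 2) / 2) with (- (m / 2 / 2)) by field.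
  unfold cosh, sinh. rewrite !Ropp_involutive, !cos_neg, !sin_neg.
  destruct e; field.
Qed.

Lemma modeD_parity (k : nat) (m : R) (e : bool) (a b c : R) :
  modeD k m e a b c 0 = (if e then 1 else -1) * (-1) ^ k * modeD k m e a b c 1.
Proof.
  revert e a b c. induction k as [|k IH]; intros e a b c.
  - simpl. rewrite mode_parity. ring.
  - simpl modeD. rewrite IH. destruct e; simpl; ring.
Qed.

(** Both functions solve the same equation, so their concomitant is constant. The boundary
    conditions remove half of its terms, and parity turns the values of the mode at 0 into values at
    1. *)
Lemma boundary_system (m : R) (u : nat -> R -> R) (e : bool) (a b c : R) :
  chain 6 u ->
  (forall k, (k <= 2)%nat -> u k 0 = 0 /\ u k 1 = 0) ->
  (forall x, 0 <= x <= 1 -> u 6%nat x = - m ^ 6 * u 0%nat x) ->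
  let s := if e then 1 else -1 in
  (u 3%nat 1 - s * u 3%nat 0) * modeD 2 m e a b c 1
  - (u 4%nat 1 + s * u 4%nat 0) * modeD 1 m e a b c 1
  + (u 5%nat 1 - s * u 5%nat 0) * modeD 0 m e a b c 1 = 0.
Proof.
  intros Hu Hb Heq s.
  set (v := fun k => modeD k m e a b c).
  assert (Hbr : concomitant u v 1 = concomitant u v 0).
  { apply derive_eq0_const with
      (fun x => u 0%nat x * v 6%nat x - u 6%nat x * v 0%nat x); [| |lra].
    - intros t _. apply concomitant_derive; [exact Hu|apply modeD_chain].
    - intros t Ht. unfold v. rewrite modeD_6, Heq by lra. ring. }
  unfold concomitant, v in Hbr.
  destruct (Hb 0%nat ltac:(lia)) as [E1 E2]. destruct (Hb 1%nat ltac:(lia)) as [E3 E4].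
  destruct (Hb 2%nat ltac:(lia)) as [E5 E6].
  rewrite E1, E2, E3, E4, E5, E6 in Hbr.
  rewrite (modeD_parity 0), (modeD_parity 1), (modeD_parity 2) in Hbr.
  fold s in Hbr. lra.
Qed.

(* [C c], [S s], [S c], [C s] are the real and imaginary parts of [cosh] and [sinh] of a complex number,
   so the last two equations are one complex equation; it gives [X] and [Z] in terms of [Y]. *)
Lemma even_boundary_kernel (r C S c s X Y Z : R) :
  r * r = 3 -> 0 < r -> C * C = 1 + S * S -> c * c = 1 - s * s -> 0 < S * S ->
  2 * s * c <> 0 ->
  - X * (1 - 2 * (s * s)) + Y * (2 * s * c) + Z * (1 - 2 * (s * s)) = 0 ->
  X * (C * c / 2 - r / 2 * (S * s)) - Y * (r / 2 * (S * c) - C * s / 2) + Z * (C * c) = 0 ->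
  X * (S * s / 2 + r / 2 * (C * c)) - Y * (r / 2 * (C * s) + S * c / 2) + Z * (S * s) = 0 ->
  X = 0 /\ Y = 0 /\ Z = 0.
Proof.
  intros Hr Hr0 H1 H2 H3 H4 E1 E2 E3.
  (* [N] is the squared modulus of the complex [cosh], with real part [C * c] and imaginary part
     [S * s]. *)
  set (N := S * S + c * c).
  assert (HN : C * c * (C * c) + S * s * (S * s) = N)
    by (transitivity (C * C * (c * c) + S * S * (s * s)); [ring|unfold N; rewrite H1, H2; ring]).
  assert (HN0 : 0 < N) by (unfold N; nra).
  assert (HPT : C * c * (C * s) - S * s * (S * c) = s * c)
    by (transitivity (s * c * (C * C - S * S)); [ring|rewrite H1; ring]).
  assert (HPR : C * c * (S * c) + S * s * (C * s) = C * S)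
    by (transitivity (C * S * (c * c + s * s)); [ring|rewrite H2; ring]).
  (* [K1] and [K2] are the imaginary and real parts of the complex equation times the conjugate of
     that [cosh]. *)
  assert (K1 : r * X * N = Y * (r * (s * c) + C * S)).
  { rewrite <- HN, <- HPT, <- HPR. apply Rminus_diag_uniq.
    match type of E2 with ?A = 0 => match type of E3 with ?B = 0 =>
      transitivity (2 * (C * c * B - S * s * A)); [field|rewrite E2, E3; ring] end end. }
  assert (K2 : Z * N = - X * N / 2 + Y * (r * (C * S) - s * c) / 2).
  { rewrite <- HN, <- HPT, <- HPR. apply Rminus_diag_uniq.
    match type of E2 with ?A = 0 => match type of E3 with ?B = 0 =>
      transitivity (C * c * A + S * s * B); [field|rewrite E2, E3; ring] end end. }
  assert (K3 : r * (Z - X) * N = - 2 * r * (s * c) * Y).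
  { transitivity (r * (Z * N) - r * X * N); [ring|]. rewrite K2.
    transitivity (- (r * X * N) * 3 / 2 + Y * (r * r * (C * S) - r * (s * c)) / 2); [field|].
    rewrite K1, Hr. field. }
  assert (HY : Y = 0).
  (* Eliminating [X] and [Z] from [E1] leaves the determinant. For the end values of the modes,
     [2 * s * c] is [sin t] and [S * S + s * s] is half of [cosh (sqrt 3 t) - cos t]. *)
  { assert (K4 : r * (2 * s * c) * (S * S + s * s) * Y = 0).
    { transitivity (r * (2 * s * c) * (N - (1 - 2 * (s * s))) * Y);
        [unfold N; rewrite H2; ring|].
      transitivity (r * N * (- X * (1 - 2 * (s * s)) + Y * (2 * s * c) + Z * (1 - 2 * (s * s)))
        - (1 - 2 * (s * s)) * (r * (Z - X) * N + 2 * r * (s * c) * Y)); [ring|].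
      rewrite E1, K3. ring. }
    apply Rmult_integral in K4 as [K4|K4]; [|exact K4].
    exfalso. revert K4.
    apply Rmult_integral_contrapositive_currified; [|nra].
    apply Rmult_integral_contrapositive_currified; [lra|exact H4]. }
  assert (HX : X = 0).
  { rewrite HY, Rmult_0_l in K1.
    apply Rmult_integral in K1 as [K1|K1]; [|lra].
    apply Rmult_integral in K1 as [K1|K1]; [lra|exact K1]. }
  repeat split; [exact HX|exact HY|].
  rewrite HX, HY in K2. apply Rmult_eq_reg_r with N; lra.
Qed.

(** The same elimination with the complex [cosh] and [sinh] exchanged: [M] is the squared modulus of
    [sinh]. The quantity assumed nonzero becomes half of [odd_char] by [odd_char_half]. *)
Lemma odd_boundary_kernel (r C S c s X Y Z : R) :
  r * r = 3 -> 0 < r -> C * C = 1 + S * S -> c * c = 1 - s * s -> 0 < S * S ->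
  (1 - 2 * (s * s)) * (S * S + s * s) - (2 * s * c) * (2 * s * c) <> 0 ->
  - X * (2 * s * c) - Y * (1 - 2 * (s * s)) + Z * (2 * s * c) = 0 ->
  X * (S * c / 2 - r / 2 * (C * s)) - Y * (r / 2 * (C * c) - S * s / 2) + Z * (S * c) = 0 ->
  X * (C * s / 2 + r / 2 * (S * c)) - Y * (r / 2 * (S * s) + C * c / 2) + Z * (C * s) = 0 ->
  X = 0 /\ Y = 0 /\ Z = 0.
Proof.
  intros Hr Hr0 H1 H2 H3 H4 E1 E2 E3.
  set (M := S * S + s * s) in *.
  assert (HM : S * c * (S * c) + C * s * (C * s) = M)
    by (transitivity (C * C * (s * s) + S * S * (c * c)); [ring|unfold M; rewrite H1, H2; ring]).
  assert (HM0 : 0 < M) by (unfold M; nra).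
  assert (HPT : C * c * (C * s) - S * s * (S * c) = s * c)
    by (transitivity (s * c * (C * C - S * S)); [ring|rewrite H1; ring]).
  assert (HPR : C * c * (S * c) + S * s * (C * s) = C * S)
    by (transitivity (C * S * (c * c + s * s)); [ring|rewrite H2; ring]).
  assert (K1 : r * X * M = Y * (C * S - r * (s * c))).
  { rewrite <- HM, <- HPT, <- HPR. apply Rminus_diag_uniq.
    match type of E2 with ?A = 0 => match type of E3 with ?B = 0 =>
      transitivity (2 * (S * c * B - C * s * A)); [field|rewrite E2, E3; ring] end end. }
  assert (K2 : Z * M = - X * M / 2 + Y * (r * (C * S) + s * c) / 2).
  { rewrite <- HM, <- HPT, <- HPR. apply Rminus_diag_uniq.
    match type of E2 with ?A = 0 => match type of E3 with ?B = 0 =>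
      transitivity (S * c * A + C * s * B); [field|rewrite E2, E3; ring] end end. }
  assert (K3 : r * (Z - X) * M = 2 * r * (s * c) * Y).
  { transitivity (r * (Z * M) - r * X * M); [ring|]. rewrite K2.
    transitivity (- (r * X * M) * 3 / 2 + Y * (r * r * (C * S) + r * (s * c)) / 2); [field|].
    rewrite K1, Hr. field. }
  assert (HY : Y = 0).
  { assert (K4 : r * ((1 - 2 * (s * s)) * M - (2 * s * c) * (2 * s * c)) * Y = 0).
    { transitivity (- r * M * (- X * (2 * s * c) - Y * (1 - 2 * (s * s)) + Z * (2 * s * c))
        + (2 * s * c) * (r * (Z - X) * M - 2 * r * (s * c) * Y)); [ring|].
      rewrite E1, K3. ring. }
    apply Rmult_integral in K4 as [K4|K4]; [|exact K4].
    exfalso. revert K4. apply Rmult_integral_contrapositive_currified; [lra|exact H4]. }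
  assert (HX : X = 0).
  { rewrite HY, Rmult_0_l in K1.
    apply Rmult_integral in K1 as [K1|K1]; [|lra].
    apply Rmult_integral in K1 as [K1|K1]; [lra|exact K1]. }
  repeat split; [exact HX|exact HY|].
  rewrite HX, HY in K2. apply Rmult_eq_reg_r with M; lra.
Qed.

(** * End values of the modes and their boundary systems *)

Section EndValues.

Variable t : R.
Let r := sqrt 3.
Let C := cosh (r / 2 * t).
Let S := sinh (r / 2 * t).
Let c := cos (t / 2).
Let s := sin (t / 2).

(** With [m = 2 t] the phase at the end 1, half a unit from the midpoint, is [t] itself. *)
Lemma mode_end (e : bool) (a1 a2 a3 : R) :
  mode (2 * t) e a1 a2 a3 1 =
  if e then a1 * cos t + a2 * (C * c) + a3 * (S * s)
  else a1 * sin t + a2 * (S * c) + a3 * (C * s).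
Proof.
  unfold mode. replace (2 * t * (1 - 1 / 2)) with t by field. reflexivity.
Qed.

Lemma cosh_sinh_sq : C * C = 1 + S * S.
Proof.
  unfold C, S, cosh, sinh. pose proof (exp_Ropp (r / 2 * t)) as E.
  pose proof (exp_pos (r / 2 * t)). rewrite E. field. lra.
Qed.

Lemma cos_sin_sq : c * c = 1 - s * s.
Proof. pose proof (sin2_cos2 (t / 2)) as H. unfold Rsqr in H. fold c s in H. lra. Qed.

Lemma cos_half : cos t = 1 - 2 * (s * s).
Proof.
  replace t with (2 * (t / 2)) at 1 by field. rewrite cos_2a_sin. fold s. ring.
Qed.

Lemma sin_half : sin t = 2 * s * c.
Proof. replace t with (2 * (t / 2)) at 1 by field. apply sin_2a. Qed.

Lemma cosh_double : cosh (r * t) = 1 + 2 * (S * S).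
Proof.
  unfold S, cosh, sinh.
  replace (- (r * t)) with (- (r / 2 * t) + - (r / 2 * t)) by field.
  replace (r * t) with (r / 2 * t + r / 2 * t) by field.
  rewrite !exp_plus, !exp_Ropp. pose proof (exp_pos (r / 2 * t)). field. lra.
Qed.

Lemma odd_char_half : odd_char t = 2 * (cos t * (S * S + s * s) - sin t * sin t).
Proof.
  unfold odd_char. fold r. rewrite cosh_double.
  pose proof (sin2_cos2 t) as H. unfold Rsqr in H.
  replace (sin t * sin t) with (1 - cos t * cos t) by lra. rewrite cos_half. ring.
Qed.

Lemma sinh_sq_pos : 0 < t -> 0 < S * S.
Proof.
  intros Ht. cut (0 < S); [nra|]. unfold S, sinh.
  pose proof sqrt3_bounds. fold r in H.
  assert (exp (- (r / 2 * t)) < exp (r / 2 * t)) by (apply exp_increasing; nra).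
  lra.
Qed.

Lemma even_system (X Y Z : R) :
  0 < t -> sin t <> 0 ->
  (forall a1 a2 a3, X * modeD 2 (2 * t) true a1 a2 a3 1
     - Y * modeD 1 (2 * t) true a1 a2 a3 1
     + Z * modeD 0 (2 * t) true a1 a2 a3 1 = 0) ->
  X = 0 /\ Y = 0 /\ Z = 0.
Proof.
  intros Ht Hne Hall.
  pose proof sqrt3_sq as Hr. pose proof sqrt3_bounds as Hr0. fold r in Hr, Hr0.
  (* The scaled unknowns absorb the factors [m ^ 2] and [m] of the derivatives. The three unit
     coefficient vectors supply the three equations. *)
  assert (Hsys : 4 * t ^ 2 * X = 0 /\ 2 * t * Y = 0 /\ Z = 0).
  { apply (even_boundary_kernel r C S c s); auto using cosh_sinh_sq, cos_sin_sq, sinh_sq_pos;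
      try lra;
      [rewrite <- sin_half; exact Hne
      |rewrite <- (Hall 1 0 0)|rewrite <- (Hall 0 1 0)|rewrite <- (Hall 0 0 1)];
      cbn [modeD negb]; rewrite ?mode_end; fold r; rewrite ?cos_half, ?sin_half; try field.
    all: apply Rminus_diag_uniq.
    - transitivity ((r * r - 3) * (- (t ^ 2) * X * C * c)); [field|rewrite Hr; ring].
    - transitivity ((r * r - 3) * (- (t ^ 2) * X * S * s)); [field|rewrite Hr; ring]. }
  destruct Hsys as (HX & HY & HZ).
  repeat split; [| |exact HZ].
  - apply Rmult_eq_reg_l with (4 * t ^ 2); [rewrite HX; ring|]. pose proof (pow_lt t 2 Ht); lra.
  - apply Rmult_eq_reg_l with (2 * t); lra.
Qed.

Lemma odd_system (X Y Z : R) :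
  0 < t -> odd_char t <> 0 ->
  (forall a1 a2 a3, X * modeD 2 (2 * t) false a1 a2 a3 1
     - Y * modeD 1 (2 * t) false a1 a2 a3 1
     + Z * modeD 0 (2 * t) false a1 a2 a3 1 = 0) ->
  X = 0 /\ Y = 0 /\ Z = 0.
Proof.
  intros Ht Hne Hall.
  pose proof sqrt3_sq as Hr. pose proof sqrt3_bounds as Hr0. fold r in Hr, Hr0.
  assert (Hsys : 4 * t ^ 2 * X = 0 /\ 2 * t * Y = 0 /\ Z = 0).
  { apply (odd_boundary_kernel r C S c s); auto using cosh_sinh_sq, cos_sin_sq, sinh_sq_pos;
      try lra;
      [intros E; apply Hne; rewrite odd_char_half, cos_half, sin_half; lra
      |rewrite <- (Hall 1 0 0)|rewrite <- (Hall 0 1 0)|rewrite <- (Hall 0 0 1)];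
      cbn [modeD negb]; rewrite ?mode_end; fold r; rewrite ?cos_half, ?sin_half; try field.
    all: apply Rminus_diag_uniq.
    - transitivity ((r * r - 3) * (- (t ^ 2) * X * S * c)); [field|rewrite Hr; ring].
    - transitivity ((r * r - 3) * (- (t ^ 2) * X * C * s)); [field|rewrite Hr; ring]. }
  destruct Hsys as (HX & HY & HZ).
  repeat split; [| |exact HZ].
  - apply Rmult_eq_reg_l with (4 * t ^ 2); [rewrite HX; ring|]. pose proof (pow_lt t 2 Ht); lra.
  - apply Rmult_eq_reg_l with (2 * t); lra.
Qed.

End EndValues.

(** * The characteristic equation *)

(** The even system kills one of the sum and difference of the two end values of each of [u^(3)],
    [u^(4)], [u^(5)], the odd system the other. *)
Lemma chain_solution_eq0 (t : R) (u : nat -> R -> R) :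
  0 < t -> sin t <> 0 -> odd_char t <> 0 ->
  chain 6 u ->
  (forall k, (k <= 2)%nat -> u k 0 = 0 /\ u k 1 = 0) ->
  (forall x, 0 <= x <= 1 -> u 6%nat x = - (2 * t) ^ 6 * u 0%nat x) ->
  forall x, 0 <= x <= 1 -> u 0%nat x = 0.
Proof.
  intros Ht Hs HF Hu Hb Heq.
  destruct (even_system t (u 3%nat 1 - 1 * u 3%nat 0) (u 4%nat 1 + 1 * u 4%nat 0)
    (u 5%nat 1 - 1 * u 5%nat 0) Ht Hs) as (E3 & E4 & E5).
  { intros a1 a2 a3. exact (boundary_system _ u true a1 a2 a3 Hu Hb Heq). }
  destruct (odd_system t (u 3%nat 1 - -1 * u 3%nat 0) (u 4%nat 1 + -1 * u 4%nat 0)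
    (u 5%nat 1 - -1 * u 5%nat 0) Ht HF) as (O3 & O4 & O5).
  { intros a1 a2 a3. exact (boundary_system _ u false a1 a2 a3 Hu Hb Heq). }
  apply cauchy_uniqueness with ((2 * t) ^ 6); [exact Hu| |exact Heq].
  intros k Hk.
  destruct k as [|[|[|[|[|[|k]]]]]]; try lia; try (apply Hb; lia); lra.
Qed.

(** * Explicit eigenfunctions *)

Lemma modeD_S (k : nat) (m : R) (e : bool) (a b c x : R) :
  is_derive (modeD k m e a b c) x (modeD (S k) m e a b c x).
Proof. apply (modeD_chain m e a b c (S k)). lia. Qed.

(** If the mode vanished on [0,1], so would all its derivatives at the midpoint, where a combination
    of them isolates [a]. *)
Lemma mode_nonzero (m : R) (e : bool) (a b c : R) :
  m <> 0 -> a <> 0 -> exists x, 0 <= x <= 1 /\ mode m e a b c x <> 0.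
Proof.
  intros Hm Ha. apply NNPP; intros Hno.
  assert (H0 : forall k x, 0 < x < 1 -> modeD k m e a b c x = 0).
  { intros k; induction k as [|k IH]; intros x Hx.
    - apply NNPP; intros Hne. apply Hno. exists x. split; [lra|exact Hne].
    - apply derive_of_locally_constant with (modeD k m e a b c) x 0; auto.
      apply modeD_S. }
  assert (Hh : 0 < 1 / 2 < 1) by lra.
  pose proof sqrt3_sq as H3.
  apply Ha. destruct e.
  - (* D^4 - m^2 D^2 + m^4 annihilates the hyperbolic modes. *)
    assert (E : modeD 4 m true a b c (1 / 2) - m ^ 2 * modeD 2 m true a b c (1 / 2)
                + m ^ 4 * modeD 0 m true a b c (1 / 2) = 3 * m ^ 4 * a).
    { rewrite modeD_3. cbn [modeD negb]. unfold mode.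
      replace (m * (1 / 2 - 1 / 2)) with 0 by field.
      replace (sqrt 3 / 2 * 0) with 0 by ring. replace (0 / 2) with 0 by field.
      rewrite sin_0, cos_0, cosh_0, sinh_0.
      generalize dependent (sqrt 3). intros r H3.
      transitivity (3 * m ^ 4 * a + (3 - r * r) * (m ^ 4 * b / 4)); [field|].
      rewrite H3. ring. }
    rewrite !H0 in E by exact Hh.
    apply Rmult_eq_reg_l with (3 * m ^ 4); [lra|].
    apply Rmult_integral_contrapositive_currified; [lra|apply pow_nonzero, Hm].
  (* The same operator applied to the first derivative, as the odd mode itself is 0 at the
     midpoint. *)
  - assert (E : modeD 5 m false a b c (1 / 2) - m ^ 2 * modeD 3 m false a b c (1 / 2)
                + m ^ 4 * modeD 1 m false a b c (1 / 2) = 3 * m ^ 5 * a).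
    { rewrite !modeD_3. cbn [modeD negb]. unfold mode.
      replace (m * (1 / 2 - 1 / 2)) with 0 by field.
      replace (sqrt 3 / 2 * 0) with 0 by ring. replace (0 / 2) with 0 by field.
      rewrite sin_0, cos_0, cosh_0, sinh_0.
      generalize dependent (sqrt 3). intros r H3.
      transitivity (3 * m ^ 5 * a + (r * r - 3) * (m ^ 5 * c / 4)); [field|].
      rewrite H3. ring. }
    rewrite !H0 in E by exact Hh.
    apply Rmult_eq_reg_l with (3 * m ^ 5); [lra|].
    apply Rmult_integral_contrapositive_currified; [lra|apply pow_nonzero, Hm].
Qed.

Lemma mode_is_eigenvalue (m : R) (e : bool) (a b c : R) :
  m <> 0 -> a <> 0 ->
  (forall k, (k <= 2)%nat -> modeD k m e a b c 1 = 0) ->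
  is_eigenvalue (m ^ 6) 0.
Proof.
  intros Hm Ha Hb.
  assert (HD := chain_Derive_n (fun k => modeD k m e a b c) (modeD_chain m e a b c)).
  assert (HZ := chain_Derive_n (fun _ _ => 0) (fun n k x _ => is_derive_const 0 x)).
  cbv beta in HD, HZ.
  exists (modeD 0 m e a b c), (fun _ => 0).
  split; [|split; [|split; [|split; [|split]]]].
  - intros k x _. apply HD.
  - intros k x _. apply HZ.
  - intros k Hk. rewrite !(proj2 (HD _ _)). rewrite modeD_parity, Hb by exact Hk. split; ring.
  - intros k _. split; apply HZ.
  - destruct (mode_nonzero m e a b c Hm Ha) as (x & Hx & Hne).
    exists x. split; [exact Hx|left; exact Hne].
  - intros x _. rewrite (proj2 (HD _ _)), (proj2 (HZ _ _)), modeD_6. split; ring.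
Qed.

(* The coefficients are, up to a factor, the cross product of the vectors of end values and of second
   derivatives of the three even modes, so only the first derivative remains to be checked. *)
Lemma even_eigenvalue (t : R) : 0 < t -> sin t = 0 -> is_eigenvalue ((2 * t) ^ 6) 0.
Proof.
  intros Ht Hs. pose proof sqrt3_sq as Hr.
  pose proof (cosh_sinh_sq t) as H1. pose proof (cos_sin_sq t) as H2.
  pose proof (sinh_sq_pos t Ht) as H3. pose proof (sin_half t) as H4.
  set (C := cosh (sqrt 3 / 2 * t)) in *. set (S := sinh (sqrt 3 / 2 * t)) in *.
  set (c := cos (t / 2)) in *. set (s := sin (t / 2)) in *.
  apply mode_is_eigenvalue with (e := true)
    (a := C * c * (C * c) + S * s * (S * s))
    (b := - cos t * (sqrt 3 * (S * s) + C * c))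
    (c := cos t * (sqrt 3 * (C * c) - S * s)); [lra| |].
  { assert (C * c * (C * c) + S * s * (S * s) = S * S + c * c); [|nra].
    transitivity (C * C * (c * c) + S * S * (s * s)); [ring|]. rewrite H1, H2. ring. }
  intros k Hk.
  destruct k as [|[|[|k]]]; [| | |lia]; cbn [modeD negb]; rewrite mode_end;
    fold C S c s; clearbody C S c s; generalize dependent (sqrt 3); intros r Hr.
  - ring.
  - rewrite Hs.
    transitivity (t * cos t * (r * r + 1) * (s * c) * (C * C - S * S)); [field|].
    rewrite H1, Hr. transitivity (2 * t * cos t * (2 * s * c)); [ring|].
    rewrite <- H4, Hs. ring.
  - transitivity (t ^ 2 * cos t * (r * r - 3) * (C * c * (C * c) + S * s * (S * s)));
      [field|rewrite Hr; ring].
Qed.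

(** The same cross product for the three odd modes; the remaining first derivative at 1 comes out as
    [t * odd_char t]. *)
Lemma odd_eigenvalue (t : R) : 0 < t -> odd_char t = 0 -> is_eigenvalue ((2 * t) ^ 6) 0.
Proof.
  intros Ht Hs. pose proof sqrt3_sq as Hr.
  pose proof (cosh_sinh_sq t) as H1. pose proof (cos_sin_sq t) as H2.
  pose proof (sinh_sq_pos t Ht) as H3. pose proof (sin_half t) as H4.
  rewrite odd_char_half in Hs.
  set (C := cosh (sqrt 3 / 2 * t)) in *. set (S := sinh (sqrt 3 / 2 * t)) in *.
  set (c := cos (t / 2)) in *. set (s := sin (t / 2)) in *.
  apply mode_is_eigenvalue with (e := false)
    (a := S * c * (S * c) + C * s * (C * s))
    (b := - sin t * (sqrt 3 * (C * s) + S * c))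
    (c := sin t * (sqrt 3 * (S * c) - C * s)); [lra| |].
  { assert (S * c * (S * c) + C * s * (C * s) = S * S + s * s); [|nra].
    transitivity (S * S * (c * c) + C * C * (s * s)); [ring|]. rewrite H1, H2. ring. }
  intros k Hk.
  destruct k as [|[|[|k]]]; [| | |lia]; cbn [modeD negb]; rewrite mode_end;
    fold C S c s; clearbody C S c s; generalize dependent (sqrt 3); intros r Hr.
  - ring.
  - transitivity (2 * t * cos t * (S * S * (c * c) + C * C * (s * s))
      - t * sin t * (r * r + 1) * (s * c) * (C * C - S * S)); [field|].
    rewrite H1, H2, Hr.
    transitivity (2 * t * cos t * (S * S + s * s) - 2 * t * sin t * (2 * s * c)); [ring|].
    rewrite <- H4. transitivity (t * (2 * (cos t * (S * S + s * s) - sin t * sin t))); [ring|].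
    rewrite Hs. ring.
  - transitivity (t ^ 2 * sin t * (r * r - 3) * (S * c * (S * c) + C * s * (C * s)));
      [field|rewrite Hr; ring].
Qed.

Lemma eigenvalue_iff (p q : R) :
  is_eigenvalue p q <-> q = 0 /\ exists n, (2 <= n)%nat /\ p = (2 * theta n) ^ 6.
Proof.
  split.
  - intros Hev. destruct (eigenvalue_real_pos p q Hev) as [-> Hp]. split; [reflexivity|].
    set (t := Rpower p (/ 6) / 2).
    assert (Ht : 0 < t) by (unfold t, Rpower; pose proof (exp_pos (/ 6 * ln p)); lra).
    assert (Hpt : p = (2 * t) ^ 6).
    { unfold t. replace (2 * (Rpower p (/ 6) / 2)) with (Rpower p (/ 6)) by field.
      rewrite <- Rpower_pow by apply exp_pos. rewrite Rpower_mult.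
      replace (/ 6 * INR 6) with 1 by (simpl; field). symmetry; apply Rpower_1, Hp. }
    cut (sin t = 0 \/ odd_char t = 0).
    { intros Hr. apply theta_roots in Hr as (n & Hn & E); [|exact Ht].
      exists n. rewrite <- E. split; [exact Hn|exact Hpt]. }
    apply NNPP; intros Hno. apply not_or_and in Hno as [Hs HF].
    destruct Hev as (a & b & Sa & Sb & Ba & Bb & (x & Hx & Hne) & Heq).
    (* As [q = 0], the real and imaginary parts solve the same real problem separately. *)
    assert (Hz : forall u, smooth6 u -> bc3 u ->
      (forall x, 0 <= x <= 1 -> - Derive_n u 6 x = p * u x) -> u x = 0).
    { intros u Su Bu Eu.
      apply (chain_solution_eq0 t (Derive_n u) Ht Hs HF (smooth6_chain u Su)); auto.
      intros y Hy. specialize (Eu y Hy). rewrite <- Hpt.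
      change (Derive_n u 0 y) with (u y). lra. }
    destruct Hne as [Hne|Hne]; apply Hne, Hz; auto; intros y Hy;
      destruct (Heq y Hy); lra.
  - intros (-> & n & Hn & ->).
    assert (Ht : 0 < theta n) by (apply theta_pos; lia).
    destruct (proj2 (theta_roots (theta n) Ht)) as [Hs|HF]; [exists n; auto| |].
    + apply even_eigenvalue; assumption.
    + apply odd_eigenvalue; assumption.
Qed.

(** * Asymptotics *)

Lemma is_lim_seq_inv_S : is_lim_seq (fun k => / (1 + INR k)) 0.
Proof.
  apply is_lim_seq_ext with (fun k => / INR (S k)); [intros; rewrite S_INR; f_equal; ring|].
  apply (is_lim_seq_incr_1 (fun k => / INR k)).
  apply is_lim_seq_inv with (l := p_infty); [apply is_lim_seq_INR|discriminate].
Qed.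

Lemma exp_lower (k : nat) (x : R) : INR k <= x -> 1 + INR k <= exp x.
Proof. intros H. pose proof (exp_ineq1_le x). lra. Qed.

Lemma center_tau_lower (k : nat) : INR k + 3 <= center k + eps k * tau k.
Proof.
  pose proof PI_gt3. destruct (tau_spec k) as [Ht _].
  pose proof (eps_bound k (tau k) ltac:(lra)). pose proof (pos_INR k).
  rewrite center_eq. nra.
Qed.

Lemma sin_ge_half (t : R) : 0 <= t <= PI / 6 -> t / 2 <= sin t.
Proof.
  intros Ht. pose proof PI_gt3.
  destruct (Req_dec t 0) as [->|Hne]; [rewrite sin_0; lra|].
  destruct (MVT_cor2 sin cos 0 t) as (c & E & Hc); [lra|intros; apply derivable_pt_lim_sin|].
  rewrite sin_0 in E.
  assert (1 / 2 <= cos c) by (rewrite <- cos_PI3; apply cos_decr_1; lra).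
  nra.
Qed.

(** The root equation gives [sin (tau k) * cosh x <= 2], with [sin (tau k) >= tau k / 2] and
    [cosh x >= (1 + INR k) / 2]. This crude rate suffices to replace the perturbed exponent by
    [sqrt 3 * center k] later. *)
Lemma tau_bound (k : nat) : 0 <= tau k <= 8 * / (1 + INR k).
Proof.
  destruct (tau_spec k) as [Ht E]. split; [lra|].
  pose proof (sin_ge_half (tau k) ltac:(lra)) as Hs.
  pose proof (center_tau_lower k) as Hc. unfold local_odd_char in E.
  set (x := sqrt 3 * (center k + eps k * tau k)) in *.
  assert (Hx : INR k <= x).
  { unfold x. pose proof sqrt3_bounds. pose proof (pos_INR k). nra. }
  pose proof (exp_lower k x Hx). pose proof (cosh_ge_half_exp x). pose proof (pos_INR k).
  apply Rmult_le_reg_r with (1 + INR k); [lra|].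
  replace (8 * / (1 + INR k) * (1 + INR k)) with 8 by (field; lra).
  assert (tau k / 2 * ((1 + INR k) / 2) <= sin (tau k) * cosh x)
    by (apply Rmult_le_compat; lra).
  nra.
Qed.

Lemma tau_lim : is_lim_seq tau 0.
Proof.
  apply is_lim_seq_le_le with (fun _ => 0) (fun k => 8 * / (1 + INR k)).
  - apply tau_bound.
  - apply is_lim_seq_const.
  - replace (Finite 0) with (Rbar_mult 8 0) by (simpl; f_equal; ring).
    apply is_lim_seq_scal_l, is_lim_seq_inv_S.
Qed.

Lemma tau_asymptotics :
  is_lim_seq (fun k => tau k / (4 * exp (- (sqrt 3 * center k)))) 1.
Proof.
  (* [exp (f k)] and [g k] are the two exponentials of [2 cosh] at the root, divided by
     [exp (sqrt 3 * center k)]. *)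
  set (f := fun k => sqrt 3 * (eps k * tau k)).
  set (g := fun k => exp (- (sqrt 3 * center k + sqrt 3 * (center k + eps k * tau k)))).
  assert (Hf : is_lim_seq f 0).
  { replace (Finite 0) with (Rbar_mult (sqrt 3) 0) by (simpl; f_equal; ring).
    apply is_lim_seq_scal_l. apply is_lim_seq_le_le with (fun k => - tau k) tau.
    - intros k. apply eps_bound. apply tau_bound.
    - replace (Finite 0) with (Rbar_opp 0) by (simpl; f_equal; ring).
      apply -> is_lim_seq_opp. apply tau_lim.
    - apply tau_lim. }
  assert (Hg : is_lim_seq g 0).
  { apply is_lim_seq_le_le with (fun _ => 0) (fun k => / (1 + INR k));
      [|apply is_lim_seq_const|apply is_lim_seq_inv_S].
    intros k. unfold g. split; [left; apply exp_pos|].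
    rewrite exp_Ropp. pose proof (pos_INR k). apply Rinv_le_contravar; [lra|].
    apply exp_lower. pose proof (center_tau_lower k). pose proof sqrt3_bounds.
    pose proof PI_gt3. assert (0 <= center k) by (rewrite center_eq; nra). nra. }
  assert (Hs : is_lim_seq (fun k => sin (tau k)) 0).
  { rewrite <- sin_0. apply is_lim_seq_continuous; [apply continuity_sin|apply tau_lim]. }
  assert (Hsc : is_lim_seq (fun k => sin (tau k) / tau k) 1).
  { apply (is_lim_comp_seq (fun x => sin x / x)) with (x := 0);
      [apply is_lim_sinc_0| |apply tau_lim].
    exists 0%nat. intros k _. destruct (tau_spec k) as [Ht _].
    intros E. injection E. lra. }
  assert (He : is_lim_seq (fun k => exp (f k)) 1).
  { rewrite <- exp_0. apply is_lim_seq_continuous; [|exact Hf].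
    apply derivable_continuous_pt, derivable_pt_exp. }
  (* [local_odd_char k (tau k) = 0] solved for [tau k exp (sqrt 3 center k) / 4]. *)
  apply is_lim_seq_ext with
    (fun k => (2 - sin (tau k) * sin (tau k)) /
       (2 * (exp (f k) + g k) * (sin (tau k) / tau k))).
  - intros k. destruct (tau_spec k) as [Ht E]. unfold local_odd_char in E.
    pose proof (sin_ge_half (tau k) ltac:(lra)) as Hsp.
    replace (2 - sin (tau k) * sin (tau k))
      with (sin (tau k) * cosh (sqrt 3 * (center k + eps k * tau k))) by lra.
    unfold cosh, g, f.
    pose proof (exp_pos (sqrt 3 * center k)). pose proof (exp_pos (sqrt 3 * (eps k * tau k))).
    replace (sqrt 3 * (center k + eps k * tau k))
      with (sqrt 3 * center k + sqrt 3 * (eps k * tau k)) by ring.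
    rewrite !exp_Ropp, !exp_plus. field.
    repeat split; try lra.
    apply Rgt_not_eq, Rplus_lt_0_compat; [|lra].
    repeat apply Rmult_lt_0_compat; assumption.
  - replace (Finite 1) with (Finite ((2 - 0 * 0) / (2 * (1 + 0) * 1))) by (f_equal; field).
    apply is_lim_seq_div'; [| |lra].
    + apply is_lim_seq_minus'; [apply is_lim_seq_const|apply is_lim_seq_mult'; exact Hs].
    + apply is_lim_seq_mult'; [|exact Hsc].
      apply is_lim_seq_mult'; [apply is_lim_seq_const|apply is_lim_seq_plus'; assumption].
Qed.

Theorem theorem1p1 :
  exists lam delta : nat -> R,
    (* the eigenvalues, listed in (strictly) increasing order *)
    (forall m n : nat, (2 <= m)%nat -> (m < n)%nat -> lam m < lam n) /\
    (* they are exactly the eigenvalues (in particular all real) *)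
    (forall p q : R, is_eigenvalue p q <->
        (q = 0 /\ exists n : nat, (2 <= n)%nat /\ p = lam n)) /\
    (forall n : nat, (2 <= n)%nat -> Nat.even n = true ->
        lam n = (INR n * PI) ^ 6) /\
    (forall n : nat, (3 <= n)%nat -> Nat.odd n = true ->
        delta n <> 0 /\ lam n = (INR n * PI + delta n) ^ 6) /\
    (* delta_n ~ 8 (-1)^(floor(n/2)+1) exp(-(pi sqrt 3 / 2) n), n odd -> oo;
       the odd n >= 3 are enumerated as n = 2k+3 *)
    is_lim_seq
      (fun k : nat =>
         delta (2 * k + 3)%nat /
         (8 * (-1) ^ (Nat.div2 (2 * k + 3) + 1) *
          exp (- (PI * sqrt 3 / 2) * INR (2 * k + 3))))
      1 /\
    (forall n : nat, (2 <= n)%nat ->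
        (Rpower (lam n) (1 / 6) = INR n * PI <-> Nat.even n = true)).
Proof.
  assert (Hodd : forall k, 2 * theta (2 * k + 3) - INR (2 * k + 3) * PI = 2 * (eps k * tau k)).
  { intros k. rewrite theta_odd. unfold center. field. }
  assert (Hd : forall n, (3 <= n)%nat -> Nat.even n = false ->
                 2 * theta n - INR n * PI <> 0).
  { intros n Hn He. destruct (odd_ge3 n Hn He) as [k ->]. rewrite Hodd.
    destruct (tau_spec k) as [Ht _]. destruct (eps_pm k) as [-> | ->]; lra. }
  exists (fun n => (2 * theta n) ^ 6), (fun n => 2 * theta n - INR n * PI).
  split; [|split; [|split; [|split; [|split]]]].
  - intros m n Hm Hmn. pose proof (theta_incr m n Hmn). pose proof (theta_pos m ltac:(lia)).
    rewrite <- !Rpower_pow by lra. apply Rlt_Rpower_l; [apply lt_0_INR; lia|lra].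
  - exact eigenvalue_iff.
  - intros n _ He. rewrite theta_even by exact He. f_equal. field.
  - intros n Hn Ho. split; [apply Hd|f_equal; ring]; auto.
    unfold Nat.odd in Ho. destruct (Nat.even n); [discriminate|reflexivity].
  - apply is_lim_seq_ext with (2 := tau_asymptotics). intros k.
    rewrite Hodd.
    (* For [n = 2k+3] the exponent of the sign is [k + 2], so the sign equals [eps k] and cancels
       that of [delta]; the factor 2 in [delta] turns 4 into 8. *)
    replace (Nat.div2 (2 * k + 3) + 1)%nat with (2 + k)%nat.
    2:{ replace (2 * k + 3)%nat with (S (2 * (S k)))%nat by lia. rewrite Nat.div2_succ_double. lia. }
    rewrite pow_add. change ((-1) ^ k) with (eps k).
    replace (- (PI * sqrt 3 / 2) * INR (2 * k + 3)) with (- (sqrt 3 * center k))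
      by (unfold center; field).
    pose proof (exp_pos (- (sqrt 3 * center k))).
    destruct (eps_pm k) as [-> | ->]; field; lra.
  - intros n Hn. assert (Ht : 0 < 2 * theta n) by (pose proof (theta_pos n ltac:(lia)); lra).
    replace (Rpower ((2 * theta n) ^ 6) (1 / 6)) with (2 * theta n).
    2:{ rewrite <- Rpower_pow by exact Ht. rewrite Rpower_mult.
        replace (INR 6 * (1 / 6)) with 1 by (simpl; field). symmetry; apply Rpower_1, Ht. }
    destruct (Nat.even n) eqn:He.
    + split; [reflexivity|intros _]. rewrite theta_even by exact He. field.
    + split; [|discriminate]. intros E. exfalso. apply (Hd n); [|exact He|lra].
      destruct (Nat.eq_dec n 2) as [->|]; [discriminate|lia].
Qed.
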